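(* For every positive integer $c$, if $n>10(5c+12)$ and $P=A\cup B$ is a bipartite poset with $|P|\le 2n+1$ and $\dim^*(P)\ge n-c$, then $P$ contains a standard example $S_d$ with $d\ge n-(5c+12)$.
   Context: A bipartite poset is a finite poset $P$ with a partition $P=A\cup B$ where $A\subseteq\operatorname{Min}(P)$ and $B\subseteq\operatorname{Max}(P)$. With $L_1,\dots,L_N$ all linear extensions of $P$, the fractional dimension $\dim^*(P)$ is the least real $d$ such that there are non-negative reals $\alpha_1,\dots,\alpha_N$ with $\sum_i\alpha_i=d$ and, for every ordered pair $(x,y)$ of incomparable elements, $\sum\{\alpha_i: x>y\text{ in }L_i\}\ge1$. The standard example $S_d$ has minimal elements $a_1,\dots,a_d$ and maximal elements $b_1,\dots,b_d$ with $a_i<b_j$ iff $i\ne j$; ''contains'' means has a subposet isomorphic to $S_d$. *)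

(* Defs.v *)
From HB Require Import structures.
From mathcomp Require Import all_boot all_order all_algebra.
From mathcomp Require Import boolp classical_sets reals topology normedtype derive.

Set Implicit Arguments.
Unset Strict Implicit.
Unset Printing Implicit Defensive.

Import Order.TTheory GRing.Theory Num.Theory.
Import numFieldNormedType.Exports.

Local Open Scope ring_scope.

Section BipartitePoset.
Context {disp : Order.disp_t} (P : finPOrderType disp).

Definition Min : {set P} := [set x | [forall y, (y <= x)%O ==> (y == x)]].
Definition Max : {set P} := [set x | [forall y, (x <= y)%O ==> (y == x)]].

Definition bipartite (A B : {set P}) : Prop :=
  [/\ A :|: B = [set: P], [disjoint A & B], A \subset Min & B \subset Max].

End BipartitePoset.

Section FractionalDimension.
Context {disp : Order.disp_t} (P : finPOrderType disp).

(* A relation on P is stored as its graph, so that the linear extensions form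
   a finite type; (x, y) \in L means x <= y in L. *)
Definition graph_rel (L : {set P * P}) : rel P := fun x y => (x, y) \in L.

Definition is_linear_extension (L : {set P * P}) : Prop :=
  [/\ reflexive (graph_rel L), antisymmetric (graph_rel L),
      transitive (graph_rel L), total (graph_rel L)
    & forall x y : P, (x <= y)%O -> graph_rel L x y].

Definition linear_extension : finType :=
  {L : {set P * P} | `[< is_linear_extension L >]}.

Definition lt_in (L : linear_extension) (x y : P) : bool :=
  (x != y) && graph_rel (val L) x y.

Context (R : realType).

Definition fractional_realizer (alpha : linear_extension -> R) (d : R) : Prop :=
  [/\ forall L, 0 <= alpha L, \sum_L alpha L = d
    & forall x y : P, (x >< y)%O -> 1 <= \sum_(L | lt_in L y x) alpha L].

(* The infimum is a minimum: see fractional_dimension_least below. *)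
Definition fractional_dimension : R :=
  inf [set d | exists alpha, fractional_realizer alpha d]%classic.

End FractionalDimension.

Arguments fractional_dimension {disp} P R.

Section Least.
Context {disp : Order.disp_t} (P : finPOrderType disp) (R : realType).

Let is_order (L : {set P * P}) : Prop :=
  [/\ reflexive (graph_rel L), antisymmetric (graph_rel L),
      transitive (graph_rel L)
    & forall x y : P, (x <= y)%O -> graph_rel L x y].

Let insert (L : {set P * P}) (y x : P) : {set P * P} :=
  [set p | ((p.1, p.2) \in L) || (((p.1, y) \in L) && ((x, p.2) \in L))].

Let insertP (L : {set P * P}) (x y : P) :
  is_order L -> ~~ graph_rel L x y -> is_order (insert L y x).
Proof.
move=> [r a t e] nxy.
have E u v : graph_rel (insert L y x) u v =
    graph_rel L u v || (graph_rel L u y && graph_rel L x v).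
  by rewrite /graph_rel /insert inE.
split.
- by move=> u; rewrite E r.
- move=> u v; rewrite !E.
  case/andP=> /orP[uv|/andP[uy xv]] /orP[vu|/andP[vy xu]].
  + by apply: a; rewrite uv vu.
  + by move: nxy; rewrite (t _ _ _ xu (t _ _ _ uv vy)).
  + by move: nxy; rewrite (t _ _ _ xv (t _ _ _ vu uy)).
  + by move: nxy; rewrite (t _ _ _ xu uy).
- move=> v u w; rewrite !E.
  case/orP=> [uv|/andP[uy xv]] /orP[vw|/andP[vy xw]].
  + by rewrite (t _ _ _ uv vw).
  + by rewrite (t _ _ _ uv vy) xw orbT.
  + by rewrite uy (t _ _ _ xv vw) orbT.
  + by rewrite uy xw orbT.
- by move=> u v uv; rewrite E e.
Qed.

Let extend (L0 : {set P * P}) : is_order L0 ->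
  exists2 L : linear_extension P, true & L0 \subset val L.
Proof.
move=> oL0.
have [|L /maxsetP[/asboolP oL mL] sL] :=
    @maxset_exists _ (fun L => `[< is_order L >]) L0; first exact/asboolP.
have [r a t e] := oL.
suff tot : total (graph_rel L).
  have hL : `[< is_linear_extension L >] by apply/asboolP.
  by exists (exist _ L hL).
move=> x y; apply/orP; case: (boolP (graph_rel L x y)); first by left.
move=> nxy; right.
have <- : insert L y x = L.
  apply: mL; first by apply/asboolP; exact: insertP.
  by apply/fintype.subsetP => -[u v] uv; rewrite /insert inE /= uv.
rewrite /graph_rel /insert inE /=; apply/orP; right; apply/andP.
by split; [exact: r | exact: r].
Qed.

Lemma linear_extension_reverse (x y : P) :
  (x >< y)%O -> exists L : linear_extension P, lt_in L y x.
Proof.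
move=> xy.
pose L0 := [set p : P * P | (p.1 <= p.2)%O].
have E u v : graph_rel L0 u v = (u <= v)%O by rewrite /graph_rel inE.
have oL0 : is_order L0.
  split=> [u|u v|v u w|u v]; rewrite !E //.
  - by move/le_anti.
  - exact: le_trans.
have nxy : ~~ graph_rel L0 x y.
  by rewrite E; apply: contra xy; rewrite /Order.comparable => ->.
have [L _ sL] := extend (insertP oL0 nxy).
exists L; apply/andP; split.
  by apply: contraNneq nxy => ->; rewrite E.
by apply: (fintype.subsetP sL); rewrite /insert !inE /= !lexx orbT.
Qed.

Local Open Scope classical_set_scope.

Lemma fractional_dimension_least :
  (exists alpha, @fractional_realizer _ P R alpha (fractional_dimension P R)) /\
  (forall alpha d, @fractional_realizer _ P R alpha d ->
     fractional_dimension P R <= d).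
Proof.
pose I := linear_extension P.
pose S : set R := [set d | exists alpha, @fractional_realizer _ P R alpha d].
have lbS : lbound S 0.
  by move=> d [al [al0 <- _]]; apply: sumr_ge0 => L _; exact: al0.
have hlbS : has_lbound S by exists 0.
have leS al d : @fractional_realizer _ P R al d -> fractional_dimension P R <= d.
  by move=> h; apply: ge_inf => //; exists al.
split; last exact: leS.
pose d0 : R := \sum_(L : I) 1.
have h0 : @fractional_realizer _ P R (fun=> 1) d0.
  split=> // x y /linear_extension_reverse[L hL].
  by rewrite (bigD1 L) //= lerDl sumr_ge0.
pose T : topologicalType := prod_topology (fun _ : I => R : topologicalType).
have contS (p : pred I) : continuous (fun f : T => \sum_(L | p L) f L : R).
  apply: (continuous_big (op := +%R) (@add_continuous R)) => L _.
  exact: (@proj_continuous I (fun=> R : topologicalType) L).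
pose box : set T := [set f | forall L, `[0, d0] (f L)].
pose C : set T := \bigcap_(q in [set q : P * P | (q.1 >< q.2)%O])
   ((fun f : T => \sum_(L : I | lt_in L q.2 q.1) f L : R) @^-1` [set z | 1 <= z]).
have cbox : compact box.
  apply: (@tychonoff I (fun=> R : topologicalType) (fun=> `[0, d0]%classic)) => L.
  exact: segment_compact.
have cC : closed C.
  apply: closed_bigI => q _; apply: closed_comp => [f _|]; first exact: contS.
  exact: closed_ge.
have cK := compact_closedI cbox cC.
have inK al d : @fractional_realizer _ P R al d -> d <= d0 ->
    (box `&` C) (al : T).
  move=> [al0 ald alc] dd0; split.
    move=> L /=; rewrite in_itv /= al0 /= (le_trans _ dd0)//.
    by rewrite -ald (bigD1 L) //= lerDl sumr_ge0.
  by move=> [x y] /= xy; exact: alc.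
have K0 : box `&` C !=set0 by exists (fun=> 1); exact: (inK _ _ h0).
have := @compact_EVT_min T R (fun f => \sum_(L | true) f L) _ K0 cK.
case; first by apply: continuous_subspaceT; exact: contS.
move=> al /set_mem [albox alC] almin.
have hal : @fractional_realizer _ P R al (\sum_L al L).
  split=> // [L|x y xy]; last exact: (alC (x, y) xy).
  by have := albox L; rewrite /= in_itv /= => /andP[].
exists al; suff -> : fractional_dimension P R = \sum_L al L by [].
apply/eqP; rewrite eq_le (leS al _ hal) /=.
apply: lb_le_inf; first by exists d0, (fun=> 1).
move=> d [be hbe]; have [dd0|d0d] := leP d d0.
  case: (hbe) => _ <- _; apply: almin; apply/mem_set; exact: (inK _ _ hbe dd0).
apply: le_trans (ltW d0d); case: (h0) => _ <- _; apply: almin.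
by apply/mem_set; exact: (inK _ _ h0).
Qed.

End Least.

Section StandardExample.

(* inl i is the minimal element a_i and inr j the maximal element b_j *)
Definition standard_example (d : nat) : Type := ('I_d + 'I_d)%type.

HB.instance Definition _ (d : nat) := Finite.on (standard_example d).

Definition standard_le (d : nat) : rel (standard_example d) :=
  fun u v => (u == v) ||
    (if u is inl i then if v is inr j then i != j else false else false).

Lemma standard_le_refl d : reflexive (@standard_le d).
Proof. by move=> u; rewrite /standard_le eqxx. Qed.

Lemma standard_le_anti d : antisymmetric (@standard_le d).
Proof.
move=> u v; rewrite /standard_le; case: eqP => // _; case: eqP => [->//|_].
by case: u => u; case: v => v; rewrite ?andbF.
Qed.

Lemma standard_le_trans d : transitive (@standard_le d).
Proof.
move=> v u w; rewrite /standard_le.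
have [->//|_] := eqVneq u v; have [->|_] := eqVneq v w.
  by move=> /= -> _; rewrite orbT.
by case: u => // u; case: v.
Qed.

HB.instance Definition _ (d : nat) :=
  Order.Le_isPOrder.Build (Order.Disp tt tt) (standard_example d)
    (@standard_le_refl d) (@standard_le_anti d) (@standard_le_trans d).

End StandardExample.

Definition contains_standard_example {disp : Order.disp_t}
    (P : finPOrderType disp) (d : nat) : Prop :=
  exists f : standard_example d -> P,
    injective f /\ forall u v : standard_example d, (f u <= f v)%O = (u <= v)%O.

(* Main.v *)
(** Let [H] be the bipartite graph of incomparable pairs [(a, b)] in [A * B].
    For an edge [(a, b)] of [H], some linear extension puts [a] above everything
    in [B] incomparable to it and [b] below everything in [A] incomparable to
    it, so it reverses every edge of [H] sharing an endpoint with [(a, b)]. Hence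
    if a list [s] of edges meets every edge of [H] at least twice, weight [1/2]
    on each member of [s] shows that [dim* P <= 2 + |s| / 2], the [2] accounting
    for the pairs inside [A] and inside [B].

    Take a maximal matching [M] of [H], of size [m], and a maximal family of
    [t] disjoint pairs [{(a, b), (a', b')}] of edges of [M] with [(a, b')] in [H].
    The [m - 2t] edges of [M] outside these pairs form an induced matching, that
    is, a standard example. The list [M ++ M] gives [n - c <= 2 + m]. The list
    consisting of [M], the [m - 2t] unpaired edges once more, the [t] edges
    [(a, b')], and one edge at each of the [|P| - 2m] unmatched vertices gives
    [2 (n - c) <= 4 + |P| - t], so [t <= 2c + 5]. *)

Require Import Defs.
From mathcomp Require Import all_boot all_order all_algebra.
From mathcomp Require Import boolp reals.
From mathcomp Require Import zify lra.

Set Implicit Arguments.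
Unset Strict Implicit.
Unset Printing Implicit Defensive.

Import Order.TTheory GRing.Theory Num.Theory.
Local Open Scope ring_scope.

(** * Maximal packings and the elements they cover *)

Section Packing.
Context {T : finType}.

(** An element of [E] related to nothing in an inclusion-maximal packing could be added to it. This
    yields both the matching ([touches]) and the disjoint pairs of its edges ([meets]). *)
Lemma maximal_packing (E : {set T}) (r : rel T) :
  reflexive r -> symmetric r ->
  exists S : {set T}, [/\ S \subset E,
    {in S &, forall x y, r x y -> x = y}
    & {in E, forall x, exists2 y, y \in S & r x y}].
Proof.
move=> rr rs.
pose packing (S : {set T}) :=
  S \subset E /\ {in S &, forall x y, r x y -> x = y}.
have [|S /maxsetP[/asboolP[SE Sr] Smax] _] :=
    @maxset_exists _ (fun S => `[< packing S >]) set0.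
  by apply/asboolP; split=> [|x y]; rewrite ?sub0set ?inE.
exists S; split=> // x xE.
have [/exists_inP[y yS rxy]|/exists_inPn nr] := boolP [exists y in S, r x y].
  by exists y.
exists x => //; rewrite -(Smax (x |: S)) ?setU11 ?subsetUr //.
apply/asboolP; split; first by rewrite subUset sub1set xE.
move=> y z; rewrite !in_setU1 => /predU1P[->|yS] /predU1P[->|zS] //.
- by rewrite (negPf (nr _ zS)).
- by rewrite rs (negPf (nr _ yS)).
- exact: Sr.
Qed.

(** Serves at two levels: the vertices covered by a matching, and the matching edges that occur in a
    family of pairs of edges. *)
Definition ends (S : {set T * T}) : {set T} :=
  [set p.1 | p in S] :|: [set p.2 | p in S].

Lemma card_ends (S : {set T * T}) :
  {in S &, injective fst} -> {in S &, injective snd} ->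
  {in S &, forall p q, p.1 != q.2} -> #|ends S| = (2 * #|S|)%N.
Proof.
move=> i1 i2 d; rewrite /ends cardsU !card_in_imset //.
suff -> : [set p.1 | p in S] :&: [set p.2 | p in S] = set0.
  by rewrite cards0 subn0 addnn mul2n.
apply/setP=> x; rewrite !inE; apply/negP => /andP[/imsetP[p pS ->]].
by case/imsetP=> q qS e; have := d _ _ pS qS; rewrite e eqxx.
Qed.

Lemma count_enum_gt0 (S : {set T}) (a : pred T) x :
  x \in S -> a x -> (0 < count a (enum S))%N.
Proof.
by move=> xS ax; rewrite -has_count; apply/hasP; exists x; rewrite ?mem_enum.
Qed.

Lemma count_enum_gt1 (S : {set T}) (a : pred T) x y :
  x \in S -> y \in S -> x != y -> a x -> a y -> (1 < count a (enum S))%N.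
Proof.
move=> xS yS xy ax ay; rewrite -size_filter.
apply: (@uniq_leq_size _ [:: x; y]); first by rewrite /= inE xy.
by move=> z; rewrite !inE => /orP[]/eqP->; rewrite mem_filter mem_enum ?ax ?ay.
Qed.

End Packing.

(** * Linear extensions from integer keys, and half weights *)

Section LinearExtensions.
Context {disp : Order.disp_t} (P : finPOrderType disp).

Lemma linear_extension_of_key (k : P -> nat) :
  injective k -> (forall x y : P, (x < y)%O -> (k x < k y)%N) ->
  exists L : linear_extension P, forall x y, (k x < k y)%N -> lt_in L x y.
Proof.
move=> kI kM; pose S := [set p : P * P | (k p.1 <= k p.2)%N].
have SE x y : graph_rel S x y = (k x <= k y)%N by rewrite /graph_rel inE.
have SP : `[< is_linear_extension S >].
  apply/asboolP; split=> [x|x y|y x z|x y|x y]; rewrite !SE //.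
  - by rewrite -eqn_leq => /eqP/kI.
  - exact: leq_trans.
  - exact: leq_total.
  - by rewrite le_eqVlt => /predU1P[->//|/kM/ltnW].
exists (exist _ S SP) => x y kxy; rewrite /lt_in SE ltnW // andbT.
by apply: contraTneq kxy => ->; rewrite ltnn.
Qed.

(** Since [tie x < #|P|], the key [l x * #|P| + tie x] sorts lexicographically by level, then by
    tie. *)
Lemma linear_extension_of_levels (l : P -> nat) (tie : P -> 'I_#|P|) :
  injective tie -> (forall x y : P, (x < y)%O -> (l x < l y)%N) ->
  exists L : linear_extension P, forall x y,
    (l x < l y)%N || (l x == l y) && (tie x < tie y)%N -> lt_in L x y.
Proof.
move=> tI lM; pose k x := (l x * #|P| + tie x)%N.
have kl x y : (l x < l y)%N -> (k x < k y)%N.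
  by move=> lxy; rewrite /k; have := ltn_ord (tie x); nia.
have [x y kxy|x y /lM/kl//|L LP] := linear_extension_of_key (k := k).
  case: (ltngtP (l x) (l y)) => [/kl|/kl|lxy]; rewrite ?kxy ?ltnn //.
  by apply: tI; apply: val_inj; move: kxy; rewrite /k lxy => /addnI.
exists L => x y /orP[/kl/LP//|/andP[/eqP lxy txy]].
by apply: LP; rewrite /k lxy ltn_add2l.
Qed.

(** Each occurrence in [s] carries weight 1/2; [s] is a list because repetitions count. *)
Lemma fractional_dimension_le_half (R : realType) (s : seq (linear_extension P)) :
  (forall x y : P, (x >< y)%O -> (1 < count (fun L => lt_in L y x) s)%N) ->
  fractional_dimension P R *+ 2 <= (size s)%:R.
Proof.
move=> sP; pose al L : R := (count_mem L s)%:R / 2.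
have sumal (a : pred (linear_extension P)) :
    \sum_(L | a L) al L = (count a s)%:R / 2.
  rewrite /al -mulr_suml -natr_sum; congr (_%:R / _).
  elim: s {sP al} => [|L s IHs] /=; first by rewrite big1.
  rewrite big_split /= IHs; congr addn.
  have [aL|aL] := boolP (a L).
    by rewrite (bigD1 L) //= eqxx big1 // => L' /andP[_]; rewrite eq_sym => /negPf->.
  by rewrite big1 // => L' aL'; case: eqP aL => // ->; rewrite aL'.
have [_ /(_ al ((size s)%:R / 2))] := fractional_dimension_least P R.
suff /[swap] /[apply] : fractional_realizer al ((size s)%:R / 2) by lra.
split=> [L||x y xy]; first by rewrite divr_ge0.
  by rewrite sumal count_predT.
by rewrite sumal ler_pdivlMr // mul1r ler_nat sP.
Qed.

End LinearExtensions.

(** * The graph of incomparable pairs: edge covers and induced matchings *)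

Section Bipartite.
Context {disp : Order.disp_t} {P : finPOrderType disp} {A B : {set P}}.
Hypothesis AB : bipartite A B.

Let mem_side x : (x \in B) = (x \notin A).
Proof.
case: AB => cAB /pred0P dAB _ _.
have := dAB x; have : x \in A :|: B by rewrite cAB.
by rewrite !inE /=; case: (x \in A) => //= ->.
Qed.

Let lt_side (x y : P) : (x < y)%O -> x \in A /\ y \in B.
Proof.
case: AB => _ _ /subsetP mA /subsetP mB xy; rewrite mem_side.
split; [apply/negPn; rewrite -mem_side|]; apply/negP.
  move=> /mB; rewrite inE => /forallP/(_ y); rewrite (ltW xy) /=.
  by rewrite gt_eqF.
by move=> /mA; rewrite inE => /forallP/(_ x); rewrite (ltW xy) /= lt_eqF.
Qed.

Definition incomparable_pairs : {set P * P} :=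
  [set e | [&& e.1 \in A, e.2 \in B & (e.1 >< e.2)%O]].
Local Notation E := incomparable_pairs.

Definition touches (e f : P * P) : bool := (e.1 == f.1) || (e.2 == f.2).

Lemma touches_sym : symmetric touches.
Proof. by move=> e f; rewrite /touches ![_ == f.1]eq_sym ![_ == f.2]eq_sym. Qed.

Lemma reverse_touching (e : P * P) : e \in E ->
  exists L : linear_extension P,
    forall f, f \in E -> touches e f -> lt_in L f.2 f.1.
Proof.
case: e => a b; rewrite inE /= => /and3P[aA bB ab].
(* Levels upwards: the elements below b, then b, the rest of A, the rest of B,
   then a, and the elements above a. *)
pose l x : nat := (if x \in A
  then if x == a then 4 else if (x < b)%O then 0 else 2
  else if x == b then 1 else if (a < x)%O then 5 else 3)%N.
have [x y xy|L LP] := linear_extension_of_levels (l := l) (@enum_rank_inj P).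
- have [xA yB] := lt_side xy; rewrite /l xA; move: yB; rewrite mem_side => /negPf->.
  have [xa|_] := eqVneq x a; have [yb|_] := eqVneq y b; subst => //.
  + by move: ab; rewrite /Order.comparable (ltW xy).
  + by rewrite xy.
  + by rewrite xy.
  + by do 2 case: ifP.
exists L => -[x y]; rewrite inE /touches /= mem_side => /and3P[xA yA xy] t.
apply: LP; apply/orP; left; rewrite /l xA (negPf yA); move: t.
(* If [x = a], then [y] is not above [a], so its level is 1 or 3, less than 4. If only [y = b], then
   [x] is not below [b], so its level is 2, more than 1. *)
have [xa|_] := eqVneq a x; have [yb|_] := eqVneq b y; subst; rewrite ?eqxx //= => _.
- by case: ifP => // /ltW ay; move: xy; rewrite /Order.comparable ay.
- by case: ifP => // /ltW xb; move: xy; rewrite /Order.comparable xb.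
Qed.

(** Each side is an antichain, so once [A] is put below [B] the order inside each side is free. *)
Lemma same_side_extension (tie : P -> 'I_#|P|) : injective tie ->
  exists L : linear_extension P, forall x y,
    (x \notin B) && (y \in B) || ((x \in B) == (y \in B)) && (tie x < tie y)%N ->
    lt_in L x y.
Proof.
move=> tI; have [x y /lt_side[xA yB]|L LP] :=
  linear_extension_of_levels (l := fun x => (x \in B) : nat) tI.
  by rewrite yB mem_side xA.
exists L => x y h; apply: LP; move: h.
by case: (x \in B); case: (y \in B).
Qed.

(** The 4 counts [L1] and [L2], each taken twice; they put [A] below [B] and use opposite tie
    orders. *)
Lemma fractional_dimension_le_cover (R : realType) (s : seq (P * P)) :
  {in E, forall f, (1 < count (fun e => (e \in E) && touches e f) s)%N} ->
  fractional_dimension P R *+ 2 <= (size s + 4)%:R.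
Proof.
move=> sP.
have [L1 L1P] := same_side_extension (@enum_rank_inj P).
have [L2 L2P] := same_side_extension (inj_comp rev_ord_inj (@enum_rank_inj P)).
have /choice[X XP] : forall e, exists L : linear_extension P,
    forall f, e \in E -> f \in E -> touches e f -> lt_in L f.2 f.1.
  (* Pairs outside [E] get [L1] as a dummy value. *)
  move=> e; case: (boolP (e \in E)) => [/reverse_touching[L LP]|_]; last by exists L1.
  by exists L => f _; exact: LP.
have -> : (size s + 4)%N = size (map X s ++ [:: L1; L1; L2; L2]).
  by rewrite size_cat size_map.
apply: fractional_dimension_le_half => x y xy.
rewrite count_cat count_map /=.
have [fE|] := boolP ((x, y) \in E).
  rewrite ltn_addr // (leq_trans (sP _ fE)) //.
  by apply: sub_count => e /andP[eE /(XP e _ eE fE)].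
have neq : enum_rank x != enum_rank y.
  by rewrite (inj_eq enum_rank_inj); apply: contraNneq xy => ->; exact: comparablexx.
rewrite inE /= xy andbT -[x \in A]negbK -mem_side => nE.
(* Outside [E], either [x] and [y] share a side and one tie order reverses them, or [x] is in [B]
   and [y] in [A]. *)
suff : lt_in L1 y x || lt_in L2 y x.
  by case: (lt_in L1 y x); case: (lt_in L2 y x); rewrite ?addnS.
move: neq; rewrite -val_eqE neq_ltn => /orP[rxy|ryx]; apply/orP; [right|left].
  apply: L2P; have -> : (rev_ord (enum_rank y) < rev_ord (enum_rank x))%N.
    apply: ltn_sub2l; last by rewrite ltnS.
    exact: leq_ltn_trans rxy (ltn_ord (enum_rank y)).
  by move: nE; case: (x \in B); case: (y \in B).
by apply: L1P; rewrite ryx; move: nE; case: (x \in B); case: (y \in B).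
Qed.

(** For distinct edges, [(e.1, f.2)] outside [E] means comparable, hence [e.1 < f.2], since nothing
    in [B] lies below an element of [A]. *)
Lemma induced_matching_standard_example (S : {set P * P}) :
  S \subset E ->
  {in S &, forall e f, e != f -> (e.1, f.2) \notin E} ->
  contains_standard_example P #|S|.
Proof.
move=> /subsetP SE Sind.
pose v (i : 'I_#|S|) : P * P := enum_val i.
pose g (u : standard_example #|S|) : P :=
  match u with inl i => (v i).1 | inr j => (v j).2 end.
have vI : injective v by exact: enum_val_inj.
have vS i : v i \in S by exact: enum_valP.
have gE i : v i \in E := SE _ (vS i).
have g1 i : (v i).1 \in A by have := gE i; rewrite inE => /and3P[].
have g2 i : (v i).2 \in B by have := gE i; rewrite inE => /and3P[].
have leE (x y : P) : ((x \in A) && (y \in B)) = false -> (x <= y)%O = (x == y).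
  rewrite le_eqVlt; case: eqP => //= _ h; apply/negP => /lt_side[xA yB].
  by rewrite xA yB in h.
suff gle u w : (g u <= g w)%O = (u <= w)%O.
  by exists g; split=> // u w guw; apply/le_anti; rewrite -!gle guw lexx.
rewrite [RHS]/Order.le /= /standard_le; case: u w => [i|i] [j|j] /=.
- rewrite leE ?orbF; last by rewrite mem_side !g1.
  apply/eqP/eqP => [gij|[->]//]; congr inl; apply: vI; apply/eqP.
  (* A shared first endpoint would make the cross pair equal to the edge [v j], which is in [E]. *)
  apply/negPn/negP => ij; have := Sind _ _ (vS i) (vS j) ij.
  by rewrite gij -surjective_pairing gE.
- have [->|ij] := eqVneq i j.
    have := gE j; rewrite inE => /and3P[_ _]; rewrite /Order.comparable.
    by rewrite negb_or => /andP[/negPf].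
  have := Sind _ _ (vS i) (vS j).
  rewrite (inj_eq vI) ij => /(_ isT); rewrite inE g1 g2 /= negbK.
  case/orP=> [->//|]; rewrite [(_ <= (v i).1)%O]leE; last first.
    by rewrite [_ \in B]mem_side g1 andbF.
  by move/eqP=> ji; have := g2 j; rewrite ji mem_side g1.
- rewrite leE; first by apply/eqP => gij; have := g2 i; rewrite gij mem_side g1.
  by have := g2 i; rewrite mem_side => /negPf->.
- rewrite leE ?orbF; last by have := g2 i; rewrite mem_side => /negPf->.
  apply/eqP/eqP => [gij|[->]//]; congr inr; apply: vI; apply/eqP.
  apply/negPn/negP => ij; have := Sind _ _ (vS i) (vS j) ij.
  by rewrite -gij -surjective_pairing gE.
Qed.

(** * The maximal matching and its two covers *)

Lemma incomparable_pairs_sides e f : e \in E -> f \in E -> e.1 != f.2.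
Proof.
rewrite !inE => /and3P[eA _ _] /and3P[_ fB _].
by apply: contraTneq fB => <-; rewrite mem_side eA.
Qed.

Lemma dimension_forces_standard_example (R : realType) : exists m t : nat,
  [/\ fractional_dimension P R *+ 2 <= (2 * m + 4)%:R,
      fractional_dimension P R *+ 2 + t%:R <= (#|P| + 4)%:R
    & contains_standard_example P (m - 2 * t)].
Proof.
have [||M [ME Mr Mmax]] := maximal_packing E (r := touches).
- by move=> e; rewrite /touches eqxx.
- exact: touches_sym.
have {}ME e : e \in M -> e \in E by move/(subsetP ME).
(* [F] collects the obstructions to [M] being induced. *)
pose F := [set p : (P * P) * (P * P) |
  [&& p.1 \in M, p.2 \in M, p.1 != p.2 & (p.1.1, p.2.2) \in E]].
pose meets (p q : (P * P) * (P * P)) :=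
  [|| p.1 == q.1, p.1 == q.2, p.2 == q.1 | p.2 == q.2].
have [||N [/subsetP NF Nr Nmax]] := maximal_packing F (r := meets).
- by move=> p; rewrite /meets eqxx.
- move=> p q; rewrite /meets ![_ == q.1]eq_sym ![_ == q.2]eq_sym.
  by congr orb; rewrite !orbA; congr orb; rewrite orbC.
have cardU : (#|~: ends M| + 2 * #|M| = #|P|)%N.
  rewrite -(card_ends (S := M)) ?[RHS](esym (cardsC (ends M))) 1?addnC //.
  - by move=> e f eM fM e1; apply: Mr; rewrite // /touches e1 eqxx.
  - by move=> e f eM fM e2; apply: Mr; rewrite // /touches e2 eqxx orbT.
  - by move=> e f /ME eE /ME; exact: incomparable_pairs_sides.
have NM : ends N \subset M.
  by apply/subsetP => e /setUP[]/imsetP[p /NF]; rewrite inE => /and4P[? ? _ _] ->.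
have cardI : (#|M :\: ends N| + 2 * #|N| = #|M|)%N.
  rewrite -(card_ends (S := N)).
  - by rewrite addnC cardsD (setIidPr NM) subnKC ?subset_leq_card.
  - by move=> p q pN qN h; apply: Nr; rewrite // /meets h eqxx.
  - by move=> p q pN qN h; apply: Nr; rewrite // /meets h eqxx !orbT.
  - move=> p q pN qN; apply/eqP => h.
    have pq : p = q by apply: Nr; rewrite // /meets h eqxx !orbT.
    by have := NF _ pN; rewrite inE h pq eqxx !andbF.
(* An isolated vertex u gets the junk pair (u, u), which is not in E. *)
pose edge_at u := odflt (u, u) [pick e in E | (e.1 == u) || (e.2 == u)].
have edge_atP u e : e \in E -> (e.1 == u) || (e.2 == u) ->
    edge_at u \in E /\ ((edge_at u).1 == u) || ((edge_at u).2 == u).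
  rewrite /edge_at; case: pickP => [e' /andP[]//|/(_ e)/= h eE eu].
  by rewrite eE eu in h.
exists #|M|, #|N|; split.
- rewrite mul2n -addnn.
  have -> : (#|M| + #|M|)%N = size (enum M ++ enum M) by rewrite size_cat -cardE.
  apply: fractional_dimension_le_cover => f fE; rewrite count_cat.
  have [e eM ef] := Mmax _ fE; rewrite touches_sym in ef.
  suff cM : (0 < count (fun e => (e \in E) && touches e f) (enum M))%N.
    exact: (leq_add cM cM).
  by apply: (count_enum_gt0 eM); rewrite ME.
- pose s := enum M ++ enum (M :\: ends N) ++
    [seq (p.1.1, p.2.2) | p <- enum N] ++ [seq edge_at u | u <- enum (~: ends M)].
  have -> : fractional_dimension P R *+ 2 + #|N|%:R <= (#|P| + 4)%:R =
      (fractional_dimension P R *+ 2 <= (size s + 4)%:R).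
    (* With m and t the sizes of [M] and [N], the list has m + (m - 2t) + t + (|P| - 2m) = |P| - t
       entries. *)
    have -> : (#|P| + 4 = size s + 4 + #|N|)%N.
      by rewrite !size_cat !size_map -!cardE; lia.
    by rewrite (natrD _ (size s + 4)) lerD2r.
  apply: fractional_dimension_le_cover => f fE; rewrite !count_cat !count_map.
  set a := fun e => _.
  set c1 := count _ (enum M); set c2 := count _ (enum (M :\: _)).
  set c3 := count _ (enum N); set c4 := count _ _.
  have aM e : e \in M -> touches e f -> a e by move=> /ME eE; rewrite /a eE.
  have c1_gt0 e : e \in M -> touches e f -> (0 < c1)%N.
    by move=> eM ef; exact: count_enum_gt0 eM (aM _ eM ef).
  have c4_gt0 u : u \notin ends M -> (f.1 == u) || (f.2 == u) -> (0 < c4)%N.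
    move=> uM fu; apply: (@count_enum_gt0 _ _ _ u); first by rewrite inE.
    have [eE] := edge_atP u f fE fu; rewrite /= /a eE /touches.
    have := incomparable_pairs_sides eE fE; have := incomparable_pairs_sides fE eE.
    case/orP: fu => /eqP-> h2 h1; last by rewrite (negPf h1) => /= ->; rewrite orbT.
    by rewrite eq_sym in h2; rewrite (negPf h2) orbF => ->.
  (* Split on which ends of [f] are matched. Two distinct edges of [M] count twice in [c1]; an edge
     of [M] counts in [c1] and in [c2] or [c3]; a single matched end gives [c1] and [c4]; no matched
     end contradicts maximality. *)
  have [/imsetP[e eM e1]|f1] := boolP (f.1 \in [set e.1 | e in M]);
  have [/imsetP[e' eM' e2]|f2] := boolP (f.2 \in [set e.2 | e in M]).
  + have [ee|ne] := eqVneq e e'; last first.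
      apply: ltn_addr; apply: (count_enum_gt1 eM eM' ne); apply: aM => //;
      by rewrite /touches ?e1 ?e2 eqxx ?orbT.
    have fe : f = e.
      by rewrite [f]surjective_pairing e1 e2 -ee -surjective_pairing.
    have {e' eM' e1 e2 ee} fM : f \in M by rewrite fe.
    have ff : touches f f by rewrite /touches eqxx.
    suff : (0 < c2 + c3)%N by have := c1_gt0 f fM ff; lia.
    have [fN|fN] := boolP (f \in ends N); last first.
      suff c2_gt0 : (0 < c2)%N by rewrite ltn_addr.
      by apply: (@count_enum_gt0 _ _ _ f); [rewrite in_setD fN | exact: aM].
    suff c3_gt0 : (0 < c3)%N by rewrite ltn_addl.
    case/setUP: fN => /imsetP[p pN fp]; apply: (count_enum_gt0 pN);
    have := NF _ pN; rewrite inE => /and4P[_ _ _ pE];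
    by rewrite /= /a pE /touches /= fp eqxx ?orbT.
  + have c1P : (0 < c1)%N by apply: (c1_gt0 e); rewrite // /touches e1 eqxx.
    suff c4P : (0 < c4)%N by lia.
    apply: (c4_gt0 f.2); last by rewrite eqxx orbT.
    rewrite in_setU negb_or f2 andbT; apply/imsetP => -[e' /ME eE fe].
    by have := incomparable_pairs_sides eE fE; rewrite -fe eqxx.
  + have c1P : (0 < c1)%N by apply: (c1_gt0 e'); rewrite // /touches e2 eqxx orbT.
    suff c4P : (0 < c4)%N by lia.
    apply: (c4_gt0 f.1); last by rewrite eqxx.
    rewrite in_setU negb_or f1; apply/imsetP => -[e /ME eE fe].
    by have := incomparable_pairs_sides fE eE; rewrite -fe eqxx.
  + have [e eM] := Mmax _ fE; rewrite /touches => /orP[]/eqP fe.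
      by rewrite fe imset_f in f1.
    by rewrite fe imset_f in f2.
- have <- : #|M :\: ends N| = (#|M| - 2 * #|N|)%N by lia.
  apply: induced_matching_standard_example => [|e f].
    by apply/subsetP => e /setDP[/ME].
  move=> /setDP[eM eN] /setDP[fM fN] ef; apply/negP => efE.
  (* A cross edge would put [(e, f)] in [F], so by maximality [e] or [f] would occur in [N]. *)
  have [|p pN] := Nmax (e, f); first by rewrite inE eM fM ef.
  by rewrite /meets => /or4P[]/eqP /= h; move: eN fN;
    rewrite h /ends !inE !imset_f ?orbT.
Qed.

End Bipartite.

Theorem theorem4p5 (R : realType) (c n : nat) (disp : Order.disp_t)
    (P : finPOrderType disp) (A B : {set P}) :
  (0 < c)%N ->
  (10 * (5 * c + 12) < n)%N ->
  bipartite A B ->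
  (#|P| <= 2 * n + 1)%N ->
  n%:R - c%:R <= fractional_dimension P R ->
  exists d : nat,
    (n - (5 * c + 12) <= d)%N /\ contains_standard_example P d.
Proof.
move=> _ _ AB cardP dimP.
have [m [t [dimm dimt SE]]] := dimension_forces_standard_example AB R.
exists (m - 2 * t)%N; split=> //.
have nm : (2 * n <= 2 * m + 4 + 2 * c)%N.
  by move: dimm; rewrite -(ler_nat R) !(natrD, natrM); lra.
have nt : (2 * n + t <= #|P| + 4 + 2 * c)%N.
  by move: dimt; rewrite -(ler_nat R) !(natrD, natrM); lra.
(* Here m >= n - c - 2 and t <= 2c + 5, so m - 2t >= n - (5c + 12). *)
lia.
Qed.
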